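(* Let $k=\mathbf{C}$, let $Q,Q'$ be quivers with rational weights $\theta,\theta'$ and dimension vectors $d,d'$ (all components positive), and let $\overline{\theta}=(\theta_a+\theta'_{a'})_{(a,a')}$, $\bar d=(d_ad'_{a'})_{(a,a')}$. Assume $d$ is coprime and $\theta$-coprime, $d'$ is coprime and $\theta'$-coprime, and $\bar d$ is $\overline{\theta}$-coprime. For $i=1,2,3$ let $N_i$ be the moduli space of stable representations of $(Q,\theta,d)$, $(Q',\theta',d')$, $(Q\otimes Q',\overline{\theta},\bar d)$ respectively, with natural line bundle $F_i$; let $\tilde N_i$ be the moduli space of stable representations of type $\mathbf{1}$ of the corresponding covering quiver $\tilde Q$, $\tilde{Q'}$, $\widetilde{Q\otimes Q'}$ (with the lifted weight), with natural line bundle $\tilde F_i$; and let $\tau_i:\tilde N_i\to N_i$, $[\tilde V]\mapsto[V]$, be the canonical morphism. Then the line bundles $\tilde F_i$ and $\tau_i^*F_i$ on $\tilde N_i$ are isomorphic for $i=1,2,3$.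
   Context: Quivers and stability. A quiver $Q=(Q_0,Q_1,\mathrm{s},\mathrm{t})$ consists of finite sets $Q_0\neq\emptyset$, $Q_1$ and maps $\mathrm{s},\mathrm{t}:Q_1\to Q_0$. Representations are families $(V_a)_a$ of finite-dimensional vector spaces with linear maps $\rho_\alpha:V_{\mathrm{s}(\alpha)}\to V_{\mathrm{t}(\alpha)}$. For $0\neq d\in\mathbf{N}^{Q_0}$ and a weight $\theta\in\mathbf{R}^{Q_0}$, $\mu_\theta(d)=\left(\sum_a\theta_ad_a\right)/\left(\sum_ad_a\right)$, and the slope of a non-zero representation is that of its dimension vector; it is $\theta$-stable if every non-zero proper subrepresentation has strictly smaller slope. $d$ is coprime if $\gcd(d_a)=1$, $\theta$-coprime if $\mu_\theta(e)\ne\mu_\theta(d)$ for all $0<e<d$ (componentwise order). The internal product $Q\otimes Q'$ has vertices $Q_0\times Q_0'$ and arrows $(Q_0\times Q_1')\sqcup(Q_1\times Q_0')$, with $(a,\alpha')$ going from $(a,\mathrm{s}(\alpha'))$ to $(a,\mathrm{t}(\alpha'))$ and $(\alpha,a')$ from $(\mathrm{s}(\alpha),a')$ to $(\mathrm{t}(\alpha),a')$. The following is described for $i=1$, i.e. $(Q,\theta,d)$; the cases $i=2,3$ are the same for $(Q',\theta',d')$ and $(Q\otimes Q',\overline{\theta},\bar d)$. Moduli and natural line bundle. Fix $V_a$ of dimension $d_a$ with ordered bases. $\mathcal{A}_1=\bigoplus_{\alpha\in Q_1}\mathrm{Hom}(V_{\mathrm{s}(\alpha)},V_{\mathrm{t}(\alpha)})$;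 $G_1=\prod_a\mathrm{Aut}(V_a)$ acts on the right by $(\rho g)_\alpha=g_{\mathrm{t}(\alpha)}^{-1}\rho_\alpha g_{\mathrm{s}(\alpha)}$; $\bar G_1$ is the quotient of $G_1$ by scalars $(c\mathbf{1}_{V_a})_a$; $\mathcal{A}_1^{\mathrm{s}}$ is the stable locus; $p_1:\mathcal{A}_1^{\mathrm{s}}\to N_1$ is the quotient by $\bar G_1$ (a holomorphic principal $\bar G_1$-bundle). Let $n$ be an integer with $n(\mu_\theta(d)-\theta_a)\in\mathbf{Z}$ for all $a$, $\chi_1(g)=\prod_a\det(g_a)^{n(\mu_\theta(d)-\theta_a)}$, and let $G_1$ act on $\mathcal{A}_1\times\mathbf{C}$ by $(\rho,v)g=(\rho g,\chi_1(g)^{-1}v)$. $F_1$ is the holomorphic line bundle on $N_1$ (unique up to isomorphism) with $p_1^*F_1$ $\bar G_1$-isomorphic to $\mathcal{A}_1^{\mathrm{s}}\times\mathbf{C}$. For $i=2$ one uses an integer $n'$ with $n'(\mu_{\theta'}(d')-\theta'_{a'})\in\mathbf{Z}$, and for $i=3$ the integer $\bar n=nn'$. Covering quiver. $\tilde Q$ has vertices $(a,\mu)$, $1\le\mu\le d_a$, and arrows $(\alpha,\mu,\nu)$, $1\le\mu\le d_{\mathrm{s}(\alpha)}$, $1\le\nu\le d_{\mathrm{t}(\alpha)}$, from $(\mathrm{s}(\alpha),\mu)$ to $(\mathrm{t}(\alpha),\nu)$; weight $\tilde\theta_{(a,\mu)}=\theta_a$; $\mathbf{1}$ is the dimension vector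 with all entries $1$ (so $\mu_{\tilde\theta}(\mathbf{1})=\mu_\theta(d)$). For a representation $V=(V,\rho)$ of $Q$, $\tilde V$ has $\tilde V_{(a,\mu)}$ the line of the $\mu$-th basis vector of $V_a$ and $\tilde\rho_{(\alpha,\mu,\nu)}$ the $(\mu,\nu)$-th matrix entry of $\rho_\alpha$ (from the $\mu$-th basis line of the source to the $\nu$-th of the target). This gives an identification $\varphi_1:\tilde{\mathcal{A}}_1=\mathcal{A}(\tilde Q,\mathbf{1})\to\mathcal{A}_1$, $\tilde\rho\mapsto\rho$, under which the paper identifies the stable loci $\tilde{\mathcal{A}}_1^{\mathrm{s}}$ and $\mathcal{A}_1^{\mathrm{s}}$. $T_1$ is $\prod_{(a,\mu)}\mathbf{C}^\times$ modulo the diagonal $\mathbf{C}^\times$; $\tilde p_1:\tilde{\mathcal{A}}_1^{\mathrm{s}}\to\tilde N_1$ is the quotient by $T_1$; $\tau_1:\tilde N_1\to N_1$ satisfies $p_1\circ\varphi_1=\tau_1\circ\tilde p_1$. $\tilde F_1$ is the natural line bundle on $\tilde N_1$ associated with $(\tilde Q,\tilde\theta,\mathbf{1})$ and the same integer $n$, defined as follows: the torus $\prod_{(a,\mu)}\mathbf{C}^\times$ acts on the right on $\tilde{\mathcal{A}}_1$ by $(\tilde\rho\,t)_{(\alpha,\mu,\nu)}=t_{(\mathrm{t}(\alpha),\nu)}^{-1}\,\tilde\rho_{(\alpha,\mu,\nu)}\,t_{(\mathrm{s}(\alpha),\mu)}$ (which induces the action of $T_1$) and on $\tilde{\mathcal{A}}_1\times\mathbf{C}$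 by $(\tilde\rho,v)t=(\tilde\rho\,t,\tilde\chi_1(t)^{-1}v)$, where $\tilde\chi_1(t)=\prod_{(a,\mu)}t_{(a,\mu)}^{n(\mu_\theta(d)-\theta_a)}$; $\tilde F_1$ is the holomorphic line bundle on $\tilde N_1$ (unique up to isomorphism) with $\tilde p_1^*\tilde F_1$ $T_1$-isomorphic to $\tilde{\mathcal{A}}_1^{\mathrm{s}}\times\mathbf{C}$.
   Formalization: τ_i need not be defined on all of Ñ_i (one arrow 1→2, d=(1,2), θ=(1,0): N_1 is empty, Ñ_1 is not); the isomorphism is proved on Ñ_i when every stable Ṽ has stable V, and in general over the open subset of classes [Ṽ] with V stable. *)

(* Defs.v *)
From HB Require Import structures.
From mathcomp Require Import all_boot all_order all_algebra.
From mathcomp Require Import all_classical all_reals all_analysis.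
From mathcomp.real_closed Require Export complex.

Set Implicit Arguments.
Unset Strict Implicit.
Unset Printing Implicit Defensive.

Import Order.TTheory GRing.Theory Num.Theory.
Import numFieldNormedType.Exports.

Local Open Scope classical_set_scope.
Local Open Scope ring_scope.
Local Open Scope quotient_scope.

Lemma invmx_mul (K : fieldType) n (A B : 'M[K]_n) :
  A \in unitmx -> B \in unitmx -> invmx (A *m B) = invmx B *m invmx A.
Proof.
move=> uA uB; have uAB : A *m B \in unitmx by rewrite unitmx_mul uA.
apply: (can_inj (mulKmx uAB)).
by rewrite mulmxV // mulmxA mulmxK // mulmxV.
Qed.

(* [Q_0] nonempty is stated as a separate hypothesis [0 < #|vertex Q|]. *)
Record quiver := Quiver {
  vertex : finType;
  arrow : finType;
  src : arrow -> vertex;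
  tgt : arrow -> vertex }.

Definition iprod (Q Q' : quiver) : quiver :=
  @Quiver (vertex Q * vertex Q')%type
    (vertex Q * arrow Q' + arrow Q * vertex Q')%type
    (fun x => match x with
              | inl (a, al') => (a, src al')
              | inr (al, a') => (src al, a')
              end)
    (fun x => match x with
              | inl (a, al') => (a, tgt al')
              | inr (al, a') => (tgt al, a')
              end).

Definition slope (Q : quiver) (theta : vertex Q -> rat) (d : vertex Q -> nat)
    : rat :=
  (\sum_a theta a * (d a)%:R) / (\sum_a d a)%N%:R.

Definition dim_coprime (Q : quiver) (d : vertex Q -> nat) : Prop :=
  \big[gcdn/0%N]_a d a = 1%N.

Definition theta_coprime (Q : quiver) (theta : vertex Q -> rat)
    (d : vertex Q -> nat) : Prop :=
  forall e : vertex Q -> nat,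
    (forall a, (e a <= d a)%N) -> (exists a, e a != 0%N) ->
    (exists a, e a != d a) -> slope theta e != slope theta d.

Definition iprod_weight (Q Q' : quiver) (theta : vertex Q -> rat)
    (theta' : vertex Q' -> rat) : vertex (iprod Q Q') -> rat :=
  fun x => theta x.1 + theta' x.2.

Definition iprod_dim (Q Q' : quiver) (d : vertex Q -> nat)
    (d' : vertex Q' -> nat) : vertex (iprod Q Q') -> nat :=
  fun x => (d x.1 * d' x.2)%N.

(* The arrow [Tagged _ (mu, nu)] over [al] goes from
    [(src al, mu)] to [(tgt al, nu)]. *)

Definition cover (Q : quiver) (d : vertex Q -> nat) : quiver :=
  @Quiver {a : vertex Q & 'I_(d a)}
    {al : arrow Q & ('I_(d (src al)) * 'I_(d (tgt al)))%type}
    (fun x => Tagged (fun a => 'I_(d a)) (tagged x).1)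
    (fun x => Tagged (fun a => 'I_(d a)) (tagged x).2).

Definition cover_weight (Q : quiver) (d : vertex Q -> nat)
    (theta : vertex Q -> rat) : vertex (cover d) -> rat :=
  fun x => theta (tag x).

Definition cover_one (Q : quiver) (d : vertex Q -> nat)
    : vertex (cover d) -> nat := fun=> 1%N.

(* With [V_a = K^(d a)] (column vectors), the space
    [\bigoplus_al Hom(V_(src al), V_(tgt al))] is realised as the space of row
    vectors listing all matrix entries, so that it is a normed space;
    [rep_mx] and [mkrep] convert to and from families of matrices. *)

Definition rep_coord (Q : quiver) (d : vertex Q -> nat) : finType :=
  {al : arrow Q & ('I_(d (tgt al)) * 'I_(d (src al)))%type}.

Notation rep K d := 'rV[K]_#|rep_coord d|.

Section Representations.
Variable K : numFieldType.
Variable Q : quiver.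
Variable d : vertex Q -> nat.

Definition rep_mx (rho : rep K d) (al : arrow Q)
    : 'M[K]_(d (tgt al), d (src al)) :=
  \matrix_(i, j) rho ord0 (enum_rank (Tagged
    (fun al => ('I_(d (tgt al)) * 'I_(d (src al)))%type) (i, j))).

Definition mkrep (A : forall al : arrow Q, 'M[K]_(d (tgt al), d (src al)))
    : rep K d :=
  \row_k A (tag (enum_val k)) (tagged (enum_val k)).1 (tagged (enum_val k)).2.

Lemma mkrepK A al : rep_mx (mkrep A) al = A al.
Proof. by apply/matrixP => i j; rewrite !mxE enum_rankK. Qed.

Lemma rep_mxK rho : mkrep (rep_mx rho) = rho.
Proof.
apply/rowP => k; rewrite !mxE; congr (rho _ _).
by rewrite -[RHS]enum_valK; congr enum_rank; case: (enum_val k) => al [].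
Qed.

Lemma rep_eqP rho rho' : (forall al, rep_mx rho al = rep_mx rho' al) ->
  rho = rho'.
Proof.
by move=> e; rewrite -[rho]rep_mxK -[rho']rep_mxK; congr mkrep;
  apply: functional_extensionality_dep.
Qed.

Definition is_subrep (rho : rep K d) (W : forall a, {vspace 'cV[K]_(d a)})
    : Prop :=
  forall al w, w \in W (src al) -> rep_mx rho al *m w \in W (tgt al).

Definition stable (theta : vertex Q -> rat) (rho : rep K d) : Prop :=
  forall W : forall a, {vspace 'cV[K]_(d a)}, is_subrep rho W ->
    (exists a, W a != 0%VS) -> (exists a, W a != fullv) ->
    slope theta (fun a => \dim (W a)) < slope theta d.

Definition in_grp (g : forall a, 'M[K]_(d a)) : Prop :=
  forall a, g a \in unitmx.

Definition act (rho : rep K d) (g : forall a, 'M[K]_(d a)) : rep K d :=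
  mkrep (fun al => invmx (g (tgt al)) *m rep_mx rho al *m g (src al)).

(* Under the hypothesis [weight_integral] the argument of [Num.floor] is an
   integer, so no rounding takes place. *)
Definition weight_integral (theta : vertex Q -> rat) (n : int) : Prop :=
  forall a, n%:~R * (slope theta d - theta a) \is a Num.int.

Definition chi (theta : vertex Q -> rat) (n : int) (g : forall a, 'M[K]_(d a))
    : K :=
  \prod_a \det (g a) ^ Num.floor (n%:~R * (slope theta d - theta a)).

(* Scalars act trivially on representations and have trivial character, so that
   orbits and equivariance are the same for the group and for its quotient by
   the scalars. *)
Lemma act_scalar (rho : rep K d) c : c != 0 -> act rho (fun=> c%:M) = rho.
Proof.
move=> c0; apply: rep_eqP => al; rewrite mkrepK invmx_scalar.
by rewrite mul_scalar_mx mul_mx_scalar scalerA divff // scale1r.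
Qed.

Lemma chi_scalar theta n c : weight_integral theta n -> c != 0 ->
  chi theta n (fun=> c%:M) = 1.
Proof.
move=> hn c0.
have uc : c \is a GRing.unit by rewrite unitfE.
rewrite /chi (eq_bigr (fun a => c ^ ((d a)%:Z *
    Num.floor (n%:~R * (slope theta d - theta a))))); last first.
  by move=> a _; rewrite det_scalar -exprz_exp.
rewrite -(@big_morph _ _ (fun m : int => c ^ m) 1 *%R 0 +%R); first last.
- exact: expr0z.
- by move=> x y /=; rewrite expfzDr.
rewrite (_ : \sum_a _ = 0) ?expr0z //; apply: (@intr_inj rat).
rewrite rmorph_sum /= (eq_bigr (fun a =>
    n%:~R * ((d a)%:R * slope theta d - theta a * (d a)%:R))); last first.
  move=> a _; rewrite rmorphM /= floorK ?hn // mulrCA mulrBr.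
  by rewrite [(d a)%:R * theta a]mulrC.
rewrite -mulr_sumr sumrB -mulr_suml -natr_sum /slope.
have [d0|d0] := eqVneq (\sum_a d a)%N 0%N; last first.
  by rewrite mulrCA divff ?pnatr_eq0 // mulr1 subrr mulr0.
rewrite d0 mul0r sub0r big1 ?oppr0 ?mulr0 // => a _.
move/eqP: d0; rewrite sum_nat_eq0 => /forallP/(_ a)/eqP ->.
by rewrite mulr0.
Qed.

Definition same_orbit (S : set (rep K d)) (x y : S) : bool :=
  `[< exists2 g, in_grp g & \val y = act (\val x) g >].

Lemma same_orbit_refl S : reflexive (@same_orbit S).
Proof.
move=> x; apply/asboolP; exists (fun=> 1%:M) => [a|]; first exact: unitmx1.
by apply: rep_eqP => al; rewrite mkrepK invmx1 mul1mx mulmx1.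
Qed.

Lemma same_orbit_trans S : transitive (@same_orbit S).
Proof.
move=> y x z /asboolP[g gG xy] /asboolP[h hG yz]; apply/asboolP.
exists (fun a => g a *m h a) => [a|]; first by rewrite unitmx_mul gG hG.
apply: rep_eqP => al; rewrite yz xy !mkrepK invmx_mul ?gG ?hG //.
by rewrite !mulmxA.
Qed.

Lemma same_orbit_sym S : symmetric (@same_orbit S).
Proof.
suff h x y : @same_orbit S x y -> same_orbit y x.
  by move=> x y; apply/idP/idP; exact: h.
move=> /asboolP[g gG xy]; apply/asboolP; exists (fun a => invmx (g a)).
  by move=> a; rewrite unitmx_inv.
apply: rep_eqP => al; rewrite xy !mkrepK invmxK !mulmxA mulmxV // mul1mx.
by rewrite -mulmxA mulmxV // mulmx1.
Qed.

Canonical same_orbit_equiv S :=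
  EquivRel (@same_orbit S) (@same_orbit_refl S) (@same_orbit_sym S)
    (@same_orbit_trans S).

End Representations.


(* A complex manifold is described by its underlying
    topological space and its sheaf of holomorphic functions; here [K] plays
    the role of the complex numbers. *)

Record anspace (K : numFieldType) := AnSpace {
  anspace_sort :> topologicalType;
  hol : set anspace_sort -> (anspace_sort -> K) -> Prop;
  hol_cst : forall U c, open U -> hol U (fun=> c);
  holD : forall U f g, open U -> hol U f -> hol U g ->
    hol U (fun x => f x + g x);
  holM : forall U f g, open U -> hol U f -> hol U g ->
    hol U (fun x => f x * g x);
  holV : forall U f, open U -> hol U f -> (forall x, U x -> f x != 0) ->
    hol U (fun x => (f x)^-1);
  hol_res : forall U V f g, open U -> open V -> U `<=` V ->
    {in U, f =1 g} -> hol V f -> hol U g;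
  hol_glue : forall U f, open U ->
    (forall x, U x -> exists V, [/\ open V, V x, V `<=` U & hol V f]) ->
    hol U f }.

Section SubSpace.
Variable K : numFieldType.
Variable V : normedModType K.
Variable S : set V.

(* Meant for [S] open in [V]: [f] is holomorphic if it is complex (Frechet)
   differentiable at each point. As [f] is only defined on [S], it is replaced
   by a function on [V] that agrees with it near the point. *)
Definition sub_hol (U : set S) (f : S -> K) : Prop :=
  forall x : S, U x -> exists2 g : V -> K,
    (\forall y \near x, f y = g (\val y)) & differentiable g (\val x).

Lemma sub_hol_cst U c : open U -> sub_hol U (fun=> c).
Proof.
move=> _ x _; exists (fun=> c); first by apply: filterE.
exact: differentiable_cst.
Qed.

Lemma sub_holD U f g : open U -> sub_hol U f -> sub_hol U g ->
  sub_hol U (fun x => f x + g x).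
Proof.
move=> _ hf hg x Ux; have [f1 e1 d1] := hf x Ux; have [g1 e2 d2] := hg x Ux.
exists (f1 + g1); last exact: differentiableD.
by apply: filterS2 e1 e2 => y -> ->.
Qed.

Lemma sub_holM U f g : open U -> sub_hol U f -> sub_hol U g ->
  sub_hol U (fun x => f x * g x).
Proof.
move=> _ hf hg x Ux; have [f1 e1 d1] := hf x Ux; have [g1 e2 d2] := hg x Ux.
exists (f1 * g1); last exact: differentiableM.
by apply: filterS2 e1 e2 => y -> ->.
Qed.

Lemma sub_holV U f : open U -> sub_hol U f -> (forall x, U x -> f x != 0) ->
  sub_hol U (fun x => (f x)^-1).
Proof.
move=> _ hf f0 x Ux; have [f1 e1 d1] := hf x Ux.
exists (fun y => (f1 y)^-1).
  by apply: filterS e1 => y ->.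
apply: differentiableV => //.
by have /= <- := nbhs_singleton e1; exact: f0.
Qed.

Lemma sub_hol_res U U' f g : open U -> open U' -> U `<=` U' ->
  {in U, f =1 g} -> sub_hol U' f -> sub_hol U g.
Proof.
move=> oU _ sU e hf x Ux; have [f1 e1 d1] := hf x (sU _ Ux).
exists f1 => //; have nU : nbhs x U by exact: open_nbhs_nbhs.
by apply: filterS2 nU e1 => y Uy <-; rewrite e // inE.
Qed.

Lemma sub_hol_glue U f : open U ->
  (forall x, U x ->
    exists V, [/\ open V, V x, V `<=` U & sub_hol V f]) ->
  sub_hol U f.
Proof. by move=> _ h x /h [W [_ Wx _ /(_ x Wx)]]. Qed.

Definition sub_space : anspace K :=
  AnSpace sub_hol_cst sub_holD sub_holM sub_holV sub_hol_res sub_hol_glue.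

End SubSpace.

(* For a principal bundle [X -> Q], a surjective submersion, this is the complex
   structure of the base. *)
Section QuotSpace.
Variable K : numFieldType.
Variable X : anspace K.
Variable Q0 : quotType X.

Local Notation Q := (quotient_topology Q0).

Definition quot_hol (U : set Q) (f : Q -> K) : Prop :=
  hol (\pi_Q @^-1` U) (f \o \pi_Q).

Let open_pi (U : set Q) : open U -> open (\pi_Q @^-1` U : set X).
Proof. by []. Qed.

Lemma quot_hol_cst U c : open U -> quot_hol U (fun=> c).
Proof. by move=> oU; exact: hol_cst. Qed.

Lemma quot_holD U f g : open U -> quot_hol U f -> quot_hol U g ->
  quot_hol U (fun x => f x + g x).
Proof. by move=> oU; exact: holD. Qed.

Lemma quot_holM U f g : open U -> quot_hol U f -> quot_hol U g ->
  quot_hol U (fun x => f x * g x).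
Proof. by move=> oU; exact: holM. Qed.

Lemma quot_holV U f : open U -> quot_hol U f -> (forall x, U x -> f x != 0) ->
  quot_hol U (fun x => (f x)^-1).
Proof. by move=> oU hf f0; apply: holV => // x; exact: f0. Qed.

Lemma quot_hol_res U V f g : open U -> open V -> U `<=` V ->
  {in U, f =1 g} -> quot_hol V f -> quot_hol U g.
Proof.
move=> oU oV sUV e; apply: hol_res => // x; first exact: sUV.
by rewrite inE => Ux; apply: e; rewrite inE.
Qed.

Lemma quot_hol_glue U f : open U ->
  (forall x, U x ->
    exists V, [/\ open V, V x, V `<=` U & quot_hol V f]) ->
  quot_hol U f.
Proof.
move=> oU h; apply: hol_glue => // x /h [V [oV Vx sVU hV]].
by exists (\pi_Q @^-1` V); split=> // y; exact: sVU.
Qed.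

Definition quot_space : anspace K :=
  AnSpace quot_hol_cst quot_holD quot_holM quot_holV quot_hol_res
    quot_hol_glue.

End QuotSpace.

Record hmorph (K : numFieldType) (X Y : anspace K) := HMorph {
  hmorph_fun :> X -> Y;
  hmorph_continuous : continuous hmorph_fun;
  hmorph_hol : forall (U : set Y) (f : Y -> K), open U -> hol U f ->
    hol (hmorph_fun @^-1` U) (f \o hmorph_fun) }.

(* A holomorphic line bundle, given by its total space, its projection and an
   atlas of local trivialisations [lb_triv i : lb_proj @^-1` lb_dom i -> K]
   with holomorphic transition functions. The trivialisations put on each
   fibre a structure of [K]-line, which does not depend on [i] by
   [lb_trans]. *)
Record line_bundle (K : numFieldType) (X : anspace K) := LineBundle {
  lb_total : Type;
  lb_proj : lb_total -> X;
  lb_idx : Type;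
  lb_dom : lb_idx -> set X;
  lb_triv : lb_idx -> lb_total -> K;
  lb_open : forall i, open (lb_dom i);
  lb_cover : forall x, exists i, lb_dom i x;
  lb_fibre : forall i x, lb_dom i x ->
    forall c, exists! e, lb_proj e = x /\ lb_triv i e = c;
  lb_trans : forall i j, exists2 g : X -> K,
    hol (lb_dom i `&` lb_dom j) g &
    forall e, (lb_dom i `&` lb_dom j) (lb_proj e) ->
      lb_triv j e = g (lb_proj e) * lb_triv i e }.

(* An isomorphism over [X], linear on fibres and holomorphic. The inverse of
   [psi] satisfies the same conditions, since bijectivity forces [h] to have no
   zeros on [lb_dom i `&` lb_dom j]. *)
Definition is_lb_iso (K : numFieldType) (X : anspace K) (L M : line_bundle X)
    (psi : lb_total L -> lb_total M) : Prop :=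
  [/\ forall e, lb_proj (psi e) = lb_proj e,
      bijective psi &
      forall i j, exists2 h : X -> K,
        hol (@lb_dom _ _ L i `&` @lb_dom _ _ M j) h &
        forall e, (@lb_dom _ _ L i `&` @lb_dom _ _ M j) (lb_proj e) ->
          lb_triv j (psi e) = h (lb_proj e) * lb_triv i e].

Definition lb_isomorphic (K : numFieldType) (X : anspace K)
    (L M : line_bundle X) : Prop :=
  exists psi : lb_total L -> lb_total M, is_lb_iso psi.

Section TrivialBundle.
Variable K : numFieldType.
Variable X : anspace K.

Let dom (_ : unit) : set X := setT.
Let triv (_ : unit) (e : X * K) : K := e.2.

Let dom_open i : open (dom i). Proof. exact: openT. Qed.
Let dom_cover x : exists i, dom i x. Proof. by exists tt. Qed.
Let triv_fibre i x : dom i x ->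
  forall c, exists! e, e.1 = x /\ triv i e = c.
Proof. by move=> _ c; exists (x, c); split=> // -[y b] /= [-> <-]. Qed.
Let triv_trans i j : exists2 g : X -> K, hol (dom i `&` dom j) g &
  forall e, (dom i `&` dom j) e.1 -> triv j e = g e.1 * triv i e.
Proof.
exists (fun=> 1) => [|e _]; last by rewrite mul1r.
by apply: hol_cst; apply: openI; exact: openT.
Qed.

Definition trivial_lb : line_bundle X :=
  LineBundle dom_open dom_cover triv_fibre triv_trans.

End TrivialBundle.

Section Pullback.
Variable K : numFieldType.
Variables X Y : anspace K.
Variable f : hmorph X Y.
Variable L : line_bundle Y.

Let total : Type := {xe : X * lb_total L | f xe.1 = lb_proj xe.2}.
Let proj (e : total) : X := (sval e).1.
Let dom (i : lb_idx L) : set X := f @^-1` lb_dom i.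
Let triv (i : lb_idx L) (e : total) : K := lb_triv i (sval e).2.

Let dom_open i : open (dom i).
Proof.
by apply: open_comp (lb_open i) => x _; exact: (@hmorph_continuous _ _ _ f).
Qed.

Let dom_cover x : exists i, dom i x.
Proof. by have [i ix] := lb_cover L (f x); exists i. Qed.

Let triv_fibre i x : dom i x ->
  forall c, exists! e, proj e = x /\ triv i e = c.
Proof.
move=> ix c; have [e [[pe te] ue]] := lb_fibre ix c.
exists (exist _ (x, e) (esym pe)); split=> //.
move=> [[y e'] h] []; rewrite /proj /triv /= => yx te'; subst y.
by apply: eq_exist; congr pair; apply: ue.
Qed.

Let triv_trans i j : exists2 g : X -> K, hol (dom i `&` dom j) g &
  forall e, (dom i `&` dom j) (proj e) -> triv j e = g (proj e) * triv i e.
Proof.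
have [g hg eg] := lb_trans i j; exists (g \o f).
  by apply: (@hmorph_hol _ _ _ f) hg; apply: openI; exact: lb_open.
move=> [[x e] /= h] dx; rewrite /triv /proj /= h.
by apply: eg; rewrite -h.
Qed.

Definition pullback : line_bundle X :=
  LineBundle dom_open dom_cover triv_fibre triv_trans.

End Pullback.

Section SubMap.
Variable K : numFieldType.
Variables V W : normedModType K.
Variables (S : set V) (T : set W).
Variable phi : V -> W.
Hypothesis dphi : forall x, differentiable phi x.
Hypothesis phiST : S `<=` phi @^-1` T.

Definition sub_map_fun (x : S) : T :=
  exist _ (phi (\val x)) (mem_set (phiST (set_mem (valP x)))).

Lemma sub_map_continuous : continuous (sub_map_fun : sub_space S -> sub_space T).
Proof.
apply/continuousP => _ [B oB <-]; exists (phi @^-1` B) => //.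
by apply: open_comp oB => x _; exact: differentiable_continuous.
Qed.

Lemma sub_map_hol (U : set (sub_space T)) (f : sub_space T -> K) :
  open U -> hol U f ->
  hol (sub_map_fun @^-1` U : set (sub_space S)) (f \o sub_map_fun).
Proof.
move=> oU hf x Ux; have [g eg dg] := hf _ Ux.
exists (g \o phi); last by apply: differentiable_comp.
exact: (sub_map_continuous eg).
Qed.

Definition sub_map : hmorph (sub_space S) (sub_space T) :=
  HMorph sub_map_continuous sub_map_hol.

End SubMap.

Section Moduli.
Variable K : numFieldType.

Definition gquot (Q : quiver) (d : vertex Q -> nat) (S : set (rep K d))
    : anspace K :=
  @quot_space K (sub_space S) {eq_quot same_orbit_equiv S}.

Definition gproj_fun (Q : quiver) (d : vertex Q -> nat) (S : set (rep K d))
    : sub_space S -> gquot S :=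
  \pi_(quotient_topology {eq_quot same_orbit_equiv S}).

Definition gproj (Q : quiver) (d : vertex Q -> nat) (S : set (rep K d))
    : hmorph (sub_space S) (gquot S) :=
  @HMorph _ (sub_space S) (gquot S) (@gproj_fun _ _ S)
    (@pi_continuous (sub_space S) {eq_quot same_orbit_equiv S})
    (fun U f _ hf => hf).

Lemma gprojP (Q : quiver) (d : vertex Q -> nat) (S : set (rep K d))
    (x y : S) : reflect (gproj S x = gproj S y) (same_orbit x y).
Proof. exact: (@eqmodP S (same_orbit_equiv S) x y). Qed.

Lemma gproj_repr (Q : quiver) (d : vertex Q -> nat) (S : set (rep K d))
    (x : gquot S) :
  gproj S (repr (x : {eq_quot same_orbit_equiv S})) = x.
Proof. exact: (reprK (x : {eq_quot same_orbit_equiv S})). Qed.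

Section Induced.
Variables (Q Q' : quiver) (d : vertex Q -> nat) (d' : vertex Q' -> nat).
Variables (S : set (rep K d)) (S' : set (rep K d')).
Variable phi : hmorph (sub_space S) (sub_space S').
Hypothesis phi_orbit : forall x y : S,
  same_orbit x y -> same_orbit (phi x : S') (phi y).

Definition gquot_map_fun (x : gquot S) : gquot S' :=
  gproj S' (phi (repr (x : {eq_quot same_orbit_equiv S}))).

Lemma gquot_map_funE x : gquot_map_fun (gproj S x) = gproj S' (phi x).
Proof.
apply: (elimT (gprojP _ _)); apply: phi_orbit.
by apply: (introT (gprojP _ _)); exact: gproj_repr.
Qed.

Lemma gquot_map_continuous : continuous gquot_map_fun.
Proof.
apply/(@quotient_continuous (sub_space S) {eq_quot same_orbit_equiv S}).
rewrite (_ : _ \o _ = gproj S' \o phi).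
  move=> x; apply: continuous_comp; exact: hmorph_continuous.
by apply/funext => x; exact: gquot_map_funE.
Qed.

Lemma gquot_map_hol (U : set (gquot S')) (f : gquot S' -> K) : open U ->
  hol U f -> hol (gquot_map_fun @^-1` U) (f \o gquot_map_fun).
Proof.
move=> oU hf.
have e : gquot_map_fun \o gproj S = gproj S' \o phi.
  by apply/funext => x; exact: gquot_map_funE.
change (@hol K (sub_space S) ((gquot_map_fun \o gproj S) @^-1` U)
  (f \o (gquot_map_fun \o gproj S))).
rewrite e; exact: (@hmorph_hol _ _ _ phi (gproj S' @^-1` U) (f \o gproj S')).
Qed.

Definition gquot_map : hmorph (gquot S) (gquot S') :=
  HMorph gquot_map_continuous gquot_map_hol.

End Induced.

Definition stable_locus (Q : quiver) (d : vertex Q -> nat)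
    (theta : vertex Q -> rat) : set (rep K d) := stable theta.

Definition moduli (Q : quiver) (d : vertex Q -> nat)
    (theta : vertex Q -> rat) : anspace K := gquot (@stable_locus Q d theta).

(* [F] is a natural line bundle for [(Q, theta, d)] and [n]: there is an
   isomorphism [psi] from its pullback to the stable locus onto the trivial
   bundle, intertwining [(rho, e) g = (rho g, e)] and
   [(rho, v) g = (rho g, (chi g)^-1 v)]. *)
Definition natural_lb (Q : quiver) (d : vertex Q -> nat)
    (theta : vertex Q -> rat) (n : int)
    (F : line_bundle (@moduli Q d theta)) : Prop :=
  let p := gproj (@stable_locus Q d theta) in
  exists2 psi : lb_total (pullback p F) -> lb_total (trivial_lb _),
    is_lb_iso psi &
    forall (g : forall a, 'M[K]_(d a)) (e e' : lb_total (pullback p F)),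
      in_grp g -> \val (lb_proj e') = act (\val (lb_proj e)) g ->
      (sval e').2 = (sval e).2 ->
      (psi e').2 = (chi theta n g)^-1 * (psi e).2.

Section Cover.
Variables (Q : quiver) (d : vertex Q -> nat) (theta : vertex Q -> rat).

Definition phi (r : rep K (@cover_one Q d)) : rep K d :=
  mkrep (fun al => \matrix_(nu, mu)
    rep_mx r (Tagged
      (fun al => ('I_(d (src al)) * 'I_(d (tgt al)))%type) (mu, nu) :
      arrow (cover d)) ord0 ord0).

Definition cover_moduli : anspace K :=
  @moduli (cover d) (@cover_one Q d) (cover_weight theta).

(* The points [rho~] for which both classes [rho~] and [phi rho~] make sense,
   that is, on which [rho~ |-> phi rho~] induces a map of moduli spaces. It may
   be smaller than the stable locus of the cover: for one arrow [1 -> 2],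
   [d = (1, 2)] and [theta = (1, 0)], a matrix with two non-zero entries is
   stable as a representation of the cover but not as one of [Q]. *)
Definition tau_locus : set (rep K (@cover_one Q d)) :=
  stable_locus (cover_weight theta) `&` phi @^-1` stable_locus theta.

Lemma phi_differentiable r : differentiable phi r.
Proof.
have lphi : linear phi.
  by move=> c r1 r2; apply/rowP => k; rewrite !mxE.
pose f : {linear rep K (@cover_one Q d) -> rep K d} :=
  HB.pack phi (GRing.isLinear.Build _ _ _ _ _ lphi).
apply: (linear_differentiable (f := f)) => x A /nbhs_ballP[e e0 eA].
apply/nbhs_ballP; exists e => // y [_ xy]; apply: eA; split=> // i k.
by rewrite !mxE; exact: xy.
Qed.

(* [phi] is equivariant for the inclusion of the torus as diagonal matrices. *)
Definition diag_grp (t : forall x : vertex (cover d), 'M[K]_(cover_one x))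
    (a : vertex Q) : 'M[K]_(d a) :=
  diag_mx (\row_mu t (Tagged (fun a => 'I_(d a)) mu) ord0 ord0).

Lemma diag_grp_unit t : in_grp t -> in_grp (diag_grp t).
Proof.
move=> tG a; rewrite unitmxE det_diag unitfE; apply/prodf_neq0 => mu _.
have := tG (Tagged (fun a => 'I_(d a)) mu).
by rewrite unitmxE unitfE mxE det_mx11.
Qed.

Lemma phiE r al nu mu : rep_mx (phi r) al nu mu =
  rep_mx r (Tagged (fun al => ('I_(d (src al)) * 'I_(d (tgt al)))%type)
    (mu, nu) : arrow (cover d)) ord0 ord0.
Proof. by rewrite mkrepK mxE. Qed.

Lemma phi_act r t : in_grp t -> phi (act r t) = act (phi r) (diag_grp t).
Proof.
move=> tG; apply: rep_eqP => al; rewrite [RHS]mkrepK.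
apply: (can_inj (mulKmx (diag_grp_unit tG (tgt al)))).
rewrite -[in RHS]mulmxA mulKVmx; last exact: diag_grp_unit.
rewrite mul_diag_mx mul_mx_diag; apply/matrixP => nu mu.
rewrite [LHS]mxE [RHS]mxE !phiE [X in X * _]mxE [X in _ = _ * X]mxE.
set al' : arrow (cover d) := Tagged _ (mu, nu).
have h : t (tgt al') *m rep_mx (act r t) al' = rep_mx r al' *m t (src al').
  by rewrite mkrepK !mulmxA mulmxV // mul1mx.
move/matrixP/(_ ord0 ord0): h; rewrite ![(_ *m _) _ _]mxE !big_ord1.
exact.
Qed.

(* [S] is either the stable locus of the cover or [tau_locus]. *)
Section Subsets.
Variable S : set (rep K (@cover_one Q d)).

Section Tau.
Hypothesis hS : S `<=` phi @^-1` stable_locus theta.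

Lemma tau_orbit (x y : S) : same_orbit x y ->
  same_orbit (sub_map phi_differentiable hS x : stable_locus theta)
    (sub_map phi_differentiable hS y).
Proof.
move=> /asboolP[t tG xy]; apply/asboolP; exists (diag_grp t).
  exact: diag_grp_unit.
by rewrite /= xy phi_act.
Qed.

Definition tau : hmorph (gquot S) (moduli d theta) := gquot_map tau_orbit.

Lemma tauE (x : S) : tau (gproj S x) =
  gproj (stable_locus theta) (sub_map phi_differentiable hS x).
Proof. exact: (gquot_map_funE tau_orbit x). Qed.

End Tau.

Section Incl.
Hypothesis hS : S `<=` stable_locus (cover_weight theta).

Lemma id_differentiable (x : rep K (@cover_one Q d)) : differentiable id x.
Proof. by []. Qed.

Lemma incl_orbit (x y : S) : same_orbit x y ->
  same_orbit
    (sub_map id_differentiable hS x : stable_locus (cover_weight theta))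
    (sub_map id_differentiable hS y).
Proof. by move=> /asboolP[t tG xy]; apply/asboolP; exists t. Qed.

Definition incl : hmorph (gquot S) cover_moduli := gquot_map incl_orbit.

End Incl.
End Subsets.

Definition tau_dom : hmorph (gquot tau_locus) (moduli d theta) :=
  tau (@subIsetr _ _ _).

Definition incl_dom : hmorph (gquot tau_locus) cover_moduli :=
  incl (@subIsetl _ _ _).

End Cover.
End Moduli.

(* Main.v *)
Require Import Defs.
From HB Require Import structures.
From mathcomp Require Import all_boot all_order all_algebra.
From mathcomp Require Import all_classical all_reals all_analysis.
From mathcomp.real_closed Require Import complex.

Set Implicit Arguments.
Unset Strict Implicit.
Unset Printing Implicit Defensive.

Import Order.TTheory GRing.Theory Num.Theory.
Import numFieldNormedType.Exports.

Local Open Scope classical_set_scope.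
Local Open Scope ring_scope.
Local Open Scope complex_scope.

(* A natural line bundle pulls back to a trivial bundle on the stable locus, on
   which the group acts through the inverse of [chi]. Since [phi] is equivariant
   for the diagonal inclusion of the torus, and [chi] restricts to the character
   of the cover there, both bundles become trivial on the locus upstairs with
   the same character. Fibrewise, the quotient of the two trivialisations is
   therefore independent of the point chosen in the orbit: it descends to an
   isomorphism, given in local trivialisations by the quotient of two nowhere
   zero holomorphic functions. *)

Lemma hmorph_open (K : numFieldType) (X Y : anspace K) (f : hmorph X Y)
  (U : set Y) : open U -> open (f @^-1` U).
Proof. by move=> oU; apply: open_comp oU => x _; exact: hmorph_continuous. Qed.

Lemma lb_triv_inj (K : numFieldType) (X : anspace K) (F : line_bundle X) i
    (e e' : lb_total F) :
  lb_dom i (lb_proj e) -> lb_proj e = lb_proj e' ->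
  lb_triv i e = lb_triv i e' -> e = e'.
Proof.
move=> ie pe te; have [e0 [_ u]] := lb_fibre ie (lb_triv i e).
by rewrite -(u e) // -(u e').
Qed.

(** * Equivariant trivialisations upstairs and the isomorphisms they induce on the quotient *)

Section Frames.
Variable K : numFieldType.
Variables (Q : quiver) (d : vertex Q -> nat) (S : set (rep K d)).

(* [a i x * lb_triv i e], for [e] over [gproj S x], is the coordinate of
   [(x, e)] in a trivialisation of the pullback of [F] to [S] under which the
   group acts on the fibre by the inverse of [c]. *)
Definition frame (c : (forall v, 'M[K]_(d v)) -> K)
    (F : line_bundle (gquot S)) (a : lb_idx F -> sub_space S -> K) : Prop :=
  [/\ forall i, hol (gproj S @^-1` lb_dom i) (a i),
      forall i x, lb_dom i (gproj S x) -> a i x != 0,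
      forall i j x e, lb_proj e = gproj S x -> lb_dom i (gproj S x) ->
        lb_dom j (gproj S x) -> a i x * lb_triv i e = a j x * lb_triv j e &
      forall g i (x y : sub_space S), in_grp g -> \val y = act (\val x) g ->
        lb_dom i (gproj S x) -> a i y = (c g)^-1 * a i x].

Lemma gproj_act (x y : sub_space S) g : in_grp g ->
  \val y = act (\val x) g -> gproj S y = gproj S x.
Proof.
move=> gG xy; apply/esym/(elimT (gprojP (x : S) (y : S))).
by apply/asboolP; exists g.
Qed.

Lemma gproj_eqP (x y : sub_space S) : gproj S x = gproj S y ->
  exists2 g, in_grp g & \val y = act (\val x) g.
Proof. by move/(introT (gprojP (x : S) (y : S)))/asboolP. Qed.

Lemma gproj_surj (z : gquot S) : exists x, gproj S x = z.
Proof. by eexists; exact: gproj_repr. Qed.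

Section TwoFrames.
Variable c : (forall v, 'M[K]_(d v)) -> K.

(** Along an orbit both frames are multiplied by the same factor [(c g)^-1], which cancels in the
    quotient. *)
Lemma frame_ratio F G a b : @frame c F a -> @frame c G b ->
  forall i j x y, gproj S x = gproj S y ->
  lb_dom i (gproj S x) -> lb_dom j (gproj S x) ->
  a i x / b j x = a i y / b j y.
Proof.
move=> [_ a0 _ ea] [_ b0 _ eb] i j x y /[dup] exy /gproj_eqP[g gG xy] ix jx.
have := a0 i y; have := b0 j y; rewrite -exy (ea _ _ _ _ gG xy ix).
(* That the factor [(c g)^-1] is nonzero is read off from [b j y != 0]. *)
rewrite (eb _ _ _ _ gG xy jx) => /(_ jx) + /(_ ix).
rewrite !mulf_eq0 !negb_or => /andP[c0 bx0] /andP[_ ax0].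
by rewrite invfM mulrACA divff // mul1r.
Qed.

(** On each fibre the map is defined from one point [x] of the orbit and one pair of
    trivialisations. The compatibility clause of [frame] removes the dependence on the
    trivialisations, [frame_ratio] that on [x]. *)
Lemma frame_map F G a b : @frame c F a -> @frame c G b ->
  exists f : lb_total F -> lb_total G,
    (forall e, lb_proj (f e) = lb_proj e) /\
    forall e i j x, gproj S x = lb_proj e -> lb_dom i (lb_proj e) ->
      lb_dom j (lb_proj e) -> b j x * lb_triv j (f e) = a i x * lb_triv i e.
Proof.
move=> fa fb.
suff /choice[f hf] : forall e, exists e' : lb_total G,
    lb_proj e' = lb_proj e /\ forall i j x, gproj S x = lb_proj e ->
      lb_dom i (lb_proj e) -> lb_dom j (lb_proj e) ->
      b j x * lb_triv j e' = a i x * lb_triv i e.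
  by exists f; split=> e; have [] := hf e.
move=> e; have [x xe] := gproj_surj (lb_proj e).
have [i ie] := lb_cover F (lb_proj e); have [j je] := lb_cover G (lb_proj e).
have [e' [[pe' te'] _]] := lb_fibre je (a i x / b j x * lb_triv i e).
exists e'; split=> // i' j' y ye i'e j'e.
have [_ b0 cb _] := fb; have [_ _ ca _] := fa.
rewrite (cb j' j) ?ye //; rewrite te' (@frame_ratio _ _ _ _ fa fb i j x y);
  rewrite ?xe ?ye //.
rewrite mulrA mulrCA divff ?mulr1 ?b0 ?ye //.
by apply: ca; rewrite ?ye.
Qed.

(** The maps obtained from [(a, b)] and from [(b, a)] are mutually inverse, since the frames vanish
    nowhere. *)
Lemma frame_isomorphic F G a b : @frame c F a -> @frame c G b ->
  lb_isomorphic F G.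
Proof.
move=> fa fb; have [f [pf tf]] := frame_map fa fb.
have [f' [pf' tf']] := frame_map fb fa.
have [ha a0 _ _] := fa; have [hb b0 _ _] := fb.
exists f; split=> // [|i j].
  exists f' => e; have [x xe] := gproj_surj (lb_proj e);
    have [i ie] := lb_cover F (lb_proj e);
    have [j je] := lb_cover G (lb_proj e).
  - apply: (@lb_triv_inj _ _ _ i); rewrite ?pf' ?pf //.
    have := tf' (f e) j i x; rewrite pf => /(_ xe je ie).
    by rewrite (tf e i j x) //; apply: mulfI; rewrite a0 ?xe.
  - apply: (@lb_triv_inj _ _ _ j); rewrite ?pf ?pf' //.
    have := tf (f' e) i j x; rewrite pf' => /(_ xe ie je).
    by rewrite (tf' e j i x) //; apply: mulfI; rewrite b0 ?xe.
(* A set-theoretic section [r] suffices: the ratio of the frames is constant on orbits, so its value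
   at [r z] depends only on [z]. *)
have [r rK] := choice gproj_surj.
have oi := lb_open (l := F) i; have oj := lb_open (l := G) j.
exists (fun z => a i (r z) / b j (r z)); last first.
  move=> e [ie je]; apply: (mulfI (b0 j (r (lb_proj e)) _)); rewrite ?rK //.
  by rewrite (tf e i j) ?rK // mulrA mulrCA divff ?mulr1 ?b0 ?rK.
have op (U : set (gquot S)) : open U -> open (gproj S @^-1` U).
  exact: hmorph_open.
set U := lb_dom i `&` lb_dom j.
have oU : open U by exact: openI.
(* Holomorphy on the quotient is by definition holomorphy after composition with [gproj S]. *)
suff : @hol K (sub_space S) (gproj S @^-1` U) (fun x => a i x / b j x).
  apply: hol_res; [exact: op|exact: op|by []|].
  move=> x; rewrite inE => -[ix jx] /=.
  by apply: (frame_ratio fa fb); rewrite ?rK.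
apply: holM; first exact: op.
- by apply: hol_res (ha i); [exact: op|exact: op|by move=> x []|].
- apply: holV; [exact: op| |by move=> x [_ jx]; exact: b0].
  by apply: hol_res (hb j); [exact: op|exact: op|by move=> x []|].
Qed.

End TwoFrames.

End Frames.

(** * Pulling frames back along equivariant maps *)

Section Frame_pullback.
Variable K : numFieldType.
Variables (Q Q' : quiver) (d : vertex Q -> nat) (d' : vertex Q' -> nat).
Variables (S : set (rep K d)) (S' : set (rep K d')).
Variable f : hmorph (sub_space S) (sub_space S').
Hypothesis f_orbit : forall x y : S,
  same_orbit x y -> same_orbit (f x : S') (f y).
Variable h : (forall v, 'M[K]_(d v)) -> (forall v, 'M[K]_(d' v)).
Hypothesis hG : forall g, in_grp g -> in_grp (h g).
Hypothesis f_act : forall g (x y : sub_space S), in_grp g ->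
  \val y = act (\val x) g -> \val (f y) = act (\val (f x)) (h g).
Variables (c : (forall v, 'M[K]_(d v)) -> K).
Variables (c' : (forall v, 'M[K]_(d' v)) -> K).
Hypothesis hc : forall g, in_grp g -> c g = c' (h g).

Lemma frame_pullback F a : @frame _ _ _ S' c' F a ->
  frame c (F := pullback (gquot_map f_orbit) F) (fun i x => a i (f x)).
Proof.
have E x : gquot_map f_orbit (gproj S x) = gproj S' (f x).
  exact: gquot_map_funE.
have D (i : lb_idx F) x :
    @lb_dom _ _ (pullback (gquot_map f_orbit) F) i (gproj S x) =
    lb_dom i (gproj S' (f x)) by rewrite -E.
move=> [ha a0 ca ea]; split.
- move=> i; rewrite (_ : _ @^-1` _ = f @^-1` (gproj S' @^-1` @lb_dom _ _ F i)).
    apply: (@hmorph_hol _ _ _ f _ (a i) _ (ha i)).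
    exact/hmorph_open/(@lb_open _ _ F i).
  by apply/funext => x; exact: D.
- by move=> i x; rewrite D; exact: a0.
- move=> i j x [[z e] ze] zx; rewrite !D => ix jx.
  by apply: ca => //; rewrite -ze -E; congr (gquot_map _ _).
- move=> g i x y gG xy; rewrite D hc // => ix.
  by apply: ea ix; [exact: hG|exact: f_act].
Qed.

End Frame_pullback.

(** * Frames of natural line bundles, and the character on diagonal matrices *)

Section Natural.
Variable K : numFieldType.
Variables (Q : quiver) (d : vertex Q -> nat) (theta : vertex Q -> rat).

(** [a i] is the coefficient of the given trivialisation [psi] with respect to [lb_triv i]. *)
Lemma natural_frame n (F : line_bundle (moduli K d theta)) : natural_lb n F ->
  exists a, frame (S := stable_locus theta) (chi theta n) (F := F) a.
Proof.
pose p := gproj (@stable_locus K Q d theta).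
move=> [psi [proj_psi [psi' psiK _] triv_psi] eq_psi].
have /choice[a ha] : forall i, exists a : sub_space (stable_locus theta) -> K,
    hol (p @^-1` lb_dom i) a /\
    forall x e (xe : p x = lb_proj e), lb_dom i (p x) ->
      (psi (exist _ (x, e) xe)).2 = a x * lb_triv i e.
  move=> i; have [a ha ea] := triv_psi i tt; exists a; split.
    by move: ha; rewrite /= setIT.
  by move=> x e xe ix; exact: (ea (exist _ (x, e) xe)).
exists a; split=> [i|i x ix|i j x e /esym xe ix jx|g i x y gG xy ix].
- by have [] := ha i.
- have [_ {}ha] := ha i; apply/eqP => ax0.
  (* If [a i x] vanished, [psi] would identify the points over [x] with coordinates 0 and 1. *)
  have [e0 [[/esym pe0 t0] _]] := lb_fibre ix 0.
  have [e1 [[/esym pe1 t1] _]] := lb_fibre ix 1.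
  suff /(can_inj psiK)/(congr1 (fun u => (sval u).2)) /= e01 :
      psi (exist _ (x, e0) pe0) = psi (exist _ (x, e1) pe1).
    by have /eqP := oner_neq0 K; apply; rewrite -t1 -t0 e01.
  rewrite [LHS]surjective_pairing [RHS]surjective_pairing !ha // ax0 !mul0r.
  by have P u : (psi u).1 = (sval u).1 := proj_psi u; rewrite !P.
- by rewrite -((ha i).2 x e xe ix) -((ha j).2 x e xe jx).
- have [_ {}ha] := ha i; have pxy := gproj_act gG xy.
  (* The same vector [e], of coordinate 1, is seen over both [x] and [y], so equivariance of [psi]
     compares [a i x] and [a i y] directly. *)
  have [e [[/esym pe te] _]] := lb_fibre ix 1.
  have pe' : p y = lb_proj e by rewrite -pe.
  have := eq_psi g (exist _ (x, e) pe) (exist _ (y, e) pe') gG xy erefl.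
  by rewrite !ha ?te ?mulr1 // /p pxy.
Qed.

(** Each vertex [a] lifts to [d a] vertices of weight [theta a]. *)
Lemma slope_cover : slope (cover_weight theta) (@cover_one Q d) = slope theta d.
Proof.
rewrite /slope; congr (_ / _%:R).
  under [RHS]eq_bigr => a _ do
    rewrite mulr_natr -[X in _ *+ X]card_ord -sumr_const.
  by rewrite sig_big_dep; apply: eq_bigr => x _; rewrite mulr1.
under [RHS]eq_bigr => a _ do rewrite -[d a]card_ord -sum1_card.
by rewrite sig_big_dep.
Qed.

(** The exponents agree by [slope_cover], and the determinant of a diagonal matrix is the product of
    its entries. *)
Lemma chi_diag_grp n (t : forall x : vertex (Defs.cover d), 'M[K]_(cover_one x)) :
  chi (cover_weight theta) n t = chi theta n (diag_grp t).
Proof.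
rewrite /chi slope_cover.
under [RHS]eq_bigr => a _.
  rewrite det_diag (big_morph (fun x : K => x ^ _) (id1 := 1) (op1 := *%R));
    [over|by move=> x y; rewrite expfzMl|exact: exp1rz].
rewrite sig_big_dep; apply: eq_bigr => -[a mu] _ /=.
by rewrite mxE det_mx11.
Qed.

End Natural.

(** * Comparison of the two bundles on the cover *)

Section Cover.
Variable K : numFieldType.
Variables (Q : quiver) (d : vertex Q -> nat) (theta : vertex Q -> rat).
Variables (n : int) (F : line_bundle (moduli K d theta)).
Variable Ft : line_bundle (cover_moduli K d theta).
Hypotheses (hF : natural_lb n F) (hFt : natural_lb n Ft).

Lemma tau_frame S (hS : S `<=` @phi K Q d @^-1` stable_locus theta) :
  exists a, frame (chi (cover_weight theta) n) (F := pullback (tau hS) F) a.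
Proof.
have [a fa] := natural_frame hF; eexists.
apply: (@frame_pullback _ _ _ _ _ _ _ _ (@tau_orbit _ _ _ _ _ hS)
  (@diag_grp K Q d)) fa.
- exact: diag_grp_unit.
- by move=> g x y gG /= ->; exact: phi_act.
- by move=> g _; exact: chi_diag_grp.
Qed.

Lemma tau_isomorphic (hS : stable_locus (cover_weight theta) `<=`
    @phi K Q d @^-1` stable_locus theta) :
  lb_isomorphic Ft (pullback (tau hS) F).
Proof.
have [a fa] := natural_frame hFt; have [b fb] := tau_frame hS.
exact: (frame_isomorphic fa fb).
Qed.

(** The inclusion of [tau_locus] is equivariant for the identity of the torus, so the frame of [Ft]
    restricts to it with unchanged character. *)
Lemma tau_dom_isomorphic : lb_isomorphic (pullback (incl_dom K d theta) Ft)
  (pullback (tau_dom K d theta) F).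
Proof.
have [a fa] := natural_frame hFt; have [b fb] := tau_frame (@subIsetr _
  (stable_locus (cover_weight theta)) (@phi K Q d @^-1` stable_locus theta)).
pose h := @subIsetl _ (stable_locus (cover_weight theta))
  (@phi K Q d @^-1` stable_locus theta).
have fa' := @frame_pullback _ _ _ _ _ _ _ _ (@incl_orbit _ _ _ theta _ h) id
  (fun _ gG => gG) (fun _ _ _ _ xy => xy) _ _ (fun _ _ => erefl) _ _ fa.
exact: (frame_isomorphic fa' fb).
Qed.

End Cover.

Theorem proposition4p8 (R : realType) (Q Q' : quiver)
  (hQ : (0 < #|vertex Q|)%N) (hQ' : (0 < #|vertex Q'|)%N)
  (theta : vertex Q -> rat) (theta' : vertex Q' -> rat)
  (d : vertex Q -> nat) (d' : vertex Q' -> nat)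
  (d_gt0 : forall a, (0 < d a)%N) (d'_gt0 : forall a, (0 < d' a)%N)
  (d_coprime : dim_coprime d) (d_theta_coprime : theta_coprime theta d)
  (d'_coprime : dim_coprime d') (d'_theta_coprime : theta_coprime theta' d')
  (dd'_coprime : theta_coprime (iprod_weight theta theta') (iprod_dim d d'))
  (n n' : int)
  (hn : weight_integral d theta n) (hn' : weight_integral d' theta' n')
  (F1 : line_bundle (moduli R[i] d theta))
  (F2 : line_bundle (moduli R[i] d' theta'))
  (F3 : line_bundle
    (moduli R[i] (iprod_dim d d') (iprod_weight theta theta')))
  (hF1 : natural_lb n F1) (hF2 : natural_lb n' F2)
  (hF3 : natural_lb (n * n') F3)
  (Ft1 : line_bundle (cover_moduli R[i] d theta))
  (Ft2 : line_bundle (cover_moduli R[i] d' theta'))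
  (Ft3 : line_bundle
    (cover_moduli R[i] (iprod_dim d d') (iprod_weight theta theta')))
  (hFt1 : natural_lb n Ft1) (hFt2 : natural_lb n' Ft2)
  (hFt3 : natural_lb (n * n') Ft3) :
  (* over the whole moduli space of the cover, as soon as [tau_i] is defined
     on all of it *)
  [/\ forall h1 : stable_locus (cover_weight theta) `<=`
          @phi R[i] Q d @^-1` stable_locus theta,
        lb_isomorphic Ft1 (pullback (tau h1) F1),
      forall h2 : stable_locus (cover_weight theta') `<=`
          @phi R[i] Q' d' @^-1` stable_locus theta',
        lb_isomorphic Ft2 (pullback (tau h2) F2) &
      forall h3 : stable_locus (cover_weight (iprod_weight theta theta')) `<=`
          @phi R[i] (iprod Q Q') (iprod_dim d d') @^-1`
            stable_locus (iprod_weight theta theta'),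
        lb_isomorphic Ft3 (pullback (tau h3) F3)] /\
  (* in general, over the open subset on which [tau_i] is defined *)
  [/\ lb_isomorphic (pullback (incl_dom R[i] d theta) Ft1)
        (pullback (tau_dom R[i] d theta) F1),
      lb_isomorphic (pullback (incl_dom R[i] d' theta') Ft2)
        (pullback (tau_dom R[i] d' theta') F2) &
      lb_isomorphic
        (pullback
          (incl_dom R[i] (iprod_dim d d') (iprod_weight theta theta')) Ft3)
        (pullback
          (tau_dom R[i] (iprod_dim d d') (iprod_weight theta theta')) F3)].
Proof.
split; split.
- exact: tau_isomorphic hF1 hFt1.
- exact: tau_isomorphic hF2 hFt2.
- exact: tau_isomorphic hF3 hFt3.
- exact: tau_dom_isomorphic hF1 hFt1.
- exact: tau_dom_isomorphic hF2 hFt2.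
- exact: tau_dom_isomorphic hF3 hFt3.
Qed.
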